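(* $0'_e$ does not have an Ahmad sequence; that is, there is no computable function $f$ with $\{\Gamma_{f(n)}(0'_e):n\in\omega\}=\{X\subseteq\omega: X<_e 0'_e\}$.
   Context: $\le_e$ is enumeration reducibility: $A\le_e B$ iff $A=\Gamma(B):=\{x:\exists\text{ finite }D\subseteq B,\ \langle x,D\rangle\in\Gamma\}$ for some c.e. set $\Gamma$; $<_e$ as usual. $(\Gamma_e)_e$ is a standard listing of all c.e. sets. $K_X=\bigoplus_e\Gamma_e(X)$ and $0'_e=K_\emptyset\oplus(\omega\setminus K_\emptyset)$ is the enumeration jump of $\emptyset$. *)

(* Defs.v *)
From mathcomp Require Import all_boot.
From mathcomp Require Import classical_sets.
From mathcomp Require Import zify.
From Stdlib Require Cantor.

Set Implicit Arguments.
Unset Strict Implicit.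
Unset Printing Implicit Defensive.

Local Open Scope classical_set_scope.

Definition cpair (x y : nat) : nat := Cantor.to_nat (x, y).

(** Unary partial recursive functions; several arguments are passed through
    the bijective pairing [cpair].  [Prec f g] is primitive recursion with base
    [f] and step [g], and [Mu f] is unbounded minimisation. *)
Inductive code : Type :=
  | Zero | Succ | Left | Right
  | Pair of code & code
  | Comp of code & code
  | Prec of code & code
  | Mu of code.

(** [eval c x y]: the program [c] halts on input [x] with output [y]. *)
Inductive eval : code -> nat -> nat -> Prop :=
  | eval_zero x : eval Zero x 0
  | eval_succ x : eval Succ x x.+1
  | eval_left x y : eval Left (cpair x y) x
  | eval_right x y : eval Right (cpair x y) y
  | eval_pair f g x u v :
      eval f x u -> eval g x v -> eval (Pair f g) x (cpair u v)
  | eval_comp f g x u v :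
      eval g x u -> eval f u v -> eval (Comp f g) x v
  | eval_prec0 f g a v :
      eval f a v -> eval (Prec f g) (cpair a 0) v
  | eval_precS f g a n u v :
      eval (Prec f g) (cpair a n) u ->
      eval g (cpair a (cpair n u)) v ->
      eval (Prec f g) (cpair a n.+1) v
  | eval_mu f a n (v : nat -> nat) :
      (forall i, i < n -> eval f (cpair a i) (v i).+1) ->
      eval f (cpair a n) 0 ->
      eval (Mu f) a n.

(** A Goedel numbering of programs, bijective by [code_num_bij] below. *)
Fixpoint code_num (c : code) : nat :=
  match c with
  | Zero => 0
  | Succ => 1
  | Left => 2
  | Right => 3
  | Pair f g => 4 * cpair (code_num f) (code_num g) + 4
  | Comp f g => 4 * cpair (code_num f) (code_num g) + 5
  | Prec f g => 4 * cpair (code_num f) (code_num g) + 6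
  | Mu f => 4 * code_num f + 7
  end.

Definition halting_set (c : code) : set nat := [set x | exists y, eval c x y].

Definition computable (f : nat -> nat) : Prop :=
  exists c, forall n, eval c n (f n).

Definition ce (A : set nat) : Prop := exists c, A = halting_set c.

(** The standard listing of the c.e. sets: [Gam e] is the domain of the [e]-th
    partial recursive function. *)
Definition Gam (e : nat) : set nat :=
  [set x | exists2 c, code_num c = e & halting_set c x].

(** The finite set with canonical index [u]: the positions of the bits 1 in
    the binary expansion of [u].  Every finite set of naturals is [canonical u]
    for exactly one [u]. *)
Definition canonical (u : nat) : set nat := [set i | odd (u %/ 2 ^ i)].

(** [eop G B] is the set written G(B); the pair <x, D> is coded with the
    canonical index of the finite set D. *)
Definition eop (G B : set nat) : set nat :=
  [set x | exists2 u, canonical u `<=` B & G (cpair x u)].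

Definition ered (A B : set nat) : Prop := exists2 G, ce G & A = eop G B.

Definition eredlt (A B : set nat) : Prop := ered A B /\ ~ ered B A.

Definition ejoin (A B : set nat) : set nat :=
  [set n | if odd n then B n./2 else A n./2].

Definition bigejoin (F : nat -> set nat) : set nat :=
  [set n | exists e x, n = cpair e x /\ F e x].

Definition Kset (X : set nat) : set nat := bigejoin (fun e => eop (Gam e) X).

Definition ejump (X : set nat) : set nat := ejoin (Kset X) (~` Kset X).

Definition zero_ejump : set nat := ejump set0.

Definition Ahmad_sequence (A : set nat) (f : nat -> nat) : Prop :=
  computable f /\
  range (fun n => eop (Gam (f n)) A) = [set X | eredlt X A].

Definition has_Ahmad_sequence (A : set nat) : Prop :=
  exists f, Ahmad_sequence A f.

Lemma cpair_inj x y x' y' : cpair x y = cpair x' y' -> x = x' /\ y = y'.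
Proof. by move/Cantor.to_nat_inj => [-> ->]. Qed.

Lemma cpair_surj n : exists x y, n = cpair x y.
Proof.
exists (Cantor.of_nat n).1, (Cantor.of_nat n).2.
by rewrite /cpair -surjective_pairing Cantor.cancel_to_of.
Qed.

Lemma cpair_ge x y : x <= cpair x y /\ y <= cpair x y.
Proof. by have := Cantor.to_nat_non_decreasing x y; rewrite /cpair; lia. Qed.

Lemma code_num_inj : injective code_num.
Proof.
elim=> [||||f IHf g IHg|f IHf g IHg|f IHf g IHg|f IHf] [||||f' g'|f' g'|f' g'|f'] //= E;
  try lia; try (by rewrite (IHf f') //; lia).
all: have /cpair_inj[/IHf-> /IHg->] // :
  cpair (code_num f) (code_num g) = cpair (code_num f') (code_num g') by lia.
Qed.

Lemma code_num_surj e : exists c, code_num c = e.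
Proof.
have [n] := ubnP e; elim: n e => // n IH e lt_en.
have [lt4|le4] := ltnP e 4.
  case: e lt4 {lt_en} => [|[|[|[|//]]]] _;
    [by exists Zero|by exists Succ|by exists Left|by exists Right].
pose q := (e - 4) %/ 4.
have [x [y Eq]] := cpair_surj q; have [lex ley] := cpair_ge x y.
have [f Ef] : exists c, code_num c = x by apply: IH; lia.
have [g Eg] : exists c, code_num c = y by apply: IH; lia.
have [h Eh] : exists c, code_num c = q by apply: IH; lia.
have : (e - 4) %% 4 < 4 by rewrite ltn_mod.
case E : ((e - 4) %% 4) => [|[|[|[|//]]]] _.
- by exists (Pair f g); rewrite /= Ef Eg -Eq; lia.
- by exists (Comp f g); rewrite /= Ef Eg -Eq; lia.
- by exists (Prec f g); rewrite /= Ef Eg -Eq; lia.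
- by exists (Mu h); rewrite /= Eh; lia.
Qed.

Lemma code_num_bij : bijective code_num.
Proof.
have h e : exists c, code_num c == e.
  by have [c <-] := code_num_surj e; exists c.
have [g gP] := boolp.choice h.
exists g => x; last exact/eqP.
by apply: code_num_inj; apply/eqP.
Qed.

Lemma Gam_code_num c : Gam (code_num c) = halting_set c.
Proof.
apply/seteqP; split=> x; last by exists c.
by move=> [c' /code_num_inj ->].
Qed.

Lemma ceP A : ce A <-> exists e, A = Gam e.
Proof.
split=> [[c ->]|[e ->]]; first by exists (code_num c); rewrite Gam_code_num.
by have [c <-] := code_num_surj e; exists c; rewrite Gam_code_num.
Qed.

Local Ltac unpair := repeat match goal with
  | E : cpair _ _ = cpair _ _ |- _ => case: (cpair_inj E) => ? ?; clear E
  end.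

Lemma eval_fun c x y y' : eval c x y -> eval c x y' -> y = y'.
Proof.
move=> H; elim: H y' => {c x y}.
- by move=> x y' H; inversion H.
- by move=> x y' H; inversion H.
- by move=> x y y' H; inversion H; unpair; subst.
- by move=> x y y' H; inversion H; unpair; subst.
- move=> f g x u v _ IHf _ IHg y' H; inversion H as [| | | |? ? ? u' v'| | | |]; subst.
  by rewrite (IHf u') ?(IHg v').
- move=> f g x u v _ IHg _ IHf y' H; inversion H as [| | | | |? ? ? u'| | |]; subst.
  by apply: IHf; rewrite (IHg u').
- by move=> f g a v _ IH y' H; inversion H; unpair; subst => //; apply: IH.
- move=> f g a n u v _ IHp _ IHg y' H.
  move: H; move Ep : (cpair a n.+1) => p H.
  inversion H as [| | | | | | |? ? ? n' u'|]; subst => //; unpair => //; subst.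
  have En : n' = n by lia.
  by subst; apply: IHg; rewrite (IHp u').
- move=> f a n v _ IHv _ IH0 y' H; inversion H as [| | | | | | | |? ? m w Hw H0]; subst.
  have [lt|lt|//] := ltngtP n y'.
  + by have := IH0 _ (Hw _ lt).
  + by have := IHv _ lt _ H0.
Qed.

(* Main.v *)
From mathcomp Require Import all_boot.
From mathcomp Require Import boolp classical_sets.
From mathcomp Require Import zify.
From Stdlib Require Cantor.
Require Import Defs.

Set Implicit Arguments.
Unset Strict Implicit.
Unset Printing Implicit Defensive.

Local Open Scope classical_set_scope.

(** Write Z for 0'_e and A_n for Gam_(f n)(Z), and suppose that the A_n are all
    incomplete. We build X <=_e Z, incomplete and different from every A_n, where
    column n of X is kept finite. The coding rule copies Z into column n of X as
    far as column n of a finite stage of A_n agrees with Z modulo X; if this went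
    on forever, column n of A_n would be Z up to finitely many elements. The
    forcing rule takes, for each e and each finite subset F of the columns <= e
    of X, the first finite set in F together with the columns > e, if any, that
    puts an element outside Z into Gam_e, and adds it to X. For F the whole
    finite part of X in columns <= e, either Gam_e(X) is not included in Z, or
    Gam_e(F + all columns > e) is a c.e. subset of Z containing Gam_e(X), hence
    Gam_e(X) <> Z since Z is not c.e. The two rules are monotone in X and
    decidable in Z, so no priority ordering is needed: X is the union of the
    finite sets all of whose elements are justified by the set itself. *)

(** * Pairing and closure properties of computable functions *)

Definition cfst (n : nat) : nat := (Cantor.of_nat n).1.
Definition csnd (n : nat) : nat := (Cantor.of_nat n).2.

Lemma cfst_cpair x y : cfst (cpair x y) = x.
Proof. by rewrite /cfst /cpair Cantor.cancel_of_to. Qed.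

Lemma csnd_cpair x y : csnd (cpair x y) = y.
Proof. by rewrite /csnd /cpair Cantor.cancel_of_to. Qed.

Definition cpairE := (cfst_cpair, csnd_cpair).

Lemma cpair_eta n : cpair (cfst n) (csnd n) = n.
Proof. by have [x [y ->]] := cpair_surj n; rewrite !cpairE. Qed.

(** Serves [justified_compact]: the coding rule for [cpair n y] consults only pairs [cpair n z] with
    [z < y], and these have smaller codes. *)
Lemma cpair_lt x y y' : y < y' -> cpair x y < cpair x y'.
Proof.
move=> lt; have := Cantor.to_nat_spec x y; have := Cantor.to_nat_spec x y'.
by rewrite /cpair; nia.
Qed.

Lemma computable_id : computable (fun a => a).
Proof.
exists (Pair Left Right) => n; rewrite -[X in eval _ _ X]cpair_eta.
by apply: eval_pair; rewrite -{1}[n]cpair_eta; constructor.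
Qed.

Lemma computable_const k : computable (fun=> k).
Proof.
elim: k => [|k [c Hc]]; first by exists Zero => n; constructor.
by exists (Comp Succ c) => n; apply: eval_comp (Hc n) _; constructor.
Qed.

Lemma computable_comp g f :
  computable g -> computable f -> computable (fun a => g (f a)).
Proof.
by move=> [c Hc] [d Hd]; exists (Comp c d) => n; apply: eval_comp (Hd n) (Hc _).
Qed.

Lemma computable_succ f : computable f -> computable (fun a => (f a).+1).
Proof. by apply: computable_comp; exists Succ => n; constructor. Qed.

Lemma computable_cfst f : computable f -> computable (fun a => cfst (f a)).
Proof.
apply: computable_comp; exists Left => n.
by rewrite -{1}[n]cpair_eta; constructor.
Qed.

Lemma computable_csnd f : computable f -> computable (fun a => csnd (f a)).
Proof.
apply: computable_comp; exists Right => n.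
by rewrite -{1}[n]cpair_eta; constructor.
Qed.

Lemma computable_cpair f g :
  computable f -> computable g -> computable (fun a => cpair (f a) (g a)).
Proof.
by move=> [c Hc] [d Hd]; exists (Pair c d) => n; apply: eval_pair.
Qed.

(** Gives access to primitive recursion without handling programs: the arithmetic functions below
    are rewritten as iterations. *)
Lemma computable_iteri b g f :
  computable b -> computable (fun p => g (cfst p) (cfst (csnd p)) (csnd (csnd p))) ->
  computable f -> computable (fun a => iteri (b a) (g a) (f a)).
Proof.
move=> [cb Hb] [cg Hg] [cf Hf].
(* [Pair Left Right] computes the identity, so [Prec] receives the parameter [a] paired with the
   counter [b a]. *)
exists (Comp (Prec cf cg) (Pair (Pair Left Right) cb)) => a.
apply: (@eval_comp _ _ _ (cpair a (b a))).
  apply: eval_pair => //.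
  by rewrite -{2}[a]cpair_eta -{1}[a]cpair_eta; apply: eval_pair; constructor.
elim: (b a) => [|n IH] /=; first exact: eval_prec0.
apply: eval_precS IH _.
by have := Hg (cpair a (cpair n (iteri n (g a) (f a)))); rewrite !cpairE.
Qed.

Lemma computable_ext f g : f =1 g -> computable f -> computable g.
Proof. by move=> fg [c Hc]; exists c => n; rewrite -fg. Qed.

Lemma computable_pred f : computable f -> computable (fun a => (f a).-1).
Proof.
move=> Hf.
apply: (@computable_ext (fun a => iteri (f a) (fun n _ => n) 0)).
  by move=> a; case: (f a).
apply: computable_iteri => //; last exact: computable_const.
exact/computable_cfst/computable_csnd/computable_id.
Qed.

Lemma computable_add f g :
  computable f -> computable g -> computable (fun a => f a + g a).
Proof.
move=> Hf Hg; apply: (@computable_ext (fun a => iteri (g a) (fun _ u => u.+1) (f a))).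
  by move=> a; elim: (g a) => [|n /= ->]; rewrite ?addn0 ?addnS.
apply: computable_iteri => //.
exact/computable_succ/computable_csnd/computable_csnd/computable_id.
Qed.

Lemma computable_sub f g :
  computable f -> computable g -> computable (fun a => f a - g a).
Proof.
move=> Hf Hg; apply: (@computable_ext (fun a => iteri (g a) (fun _ u => u.-1) (f a))).
  by move=> a; elim: (g a) => [|n /= ->]; rewrite ?subn0 ?subnS.
apply: computable_iteri => //.
exact/computable_pred/computable_csnd/computable_csnd/computable_id.
Qed.

Lemma computable_mul f g :
  computable f -> computable g -> computable (fun a => f a * g a).
Proof.
move=> Hf Hg.
apply: (@computable_ext (fun a => iteri (g a) (fun _ u => f a + u) 0)).
  by move=> a; elim: (g a) => [|n /= ->]; rewrite ?muln0 ?mulnS.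
apply: (@computable_iteri g (fun a _ u => f a + u)) => //.
  apply: computable_add.
    exact/(computable_comp Hf)/computable_cfst/computable_id.
  exact/computable_csnd/computable_csnd/computable_id.
exact: computable_const.
Qed.

Lemma computable_half f : computable f -> computable (fun a => (f a)./2).
Proof.
(* The half of [n.+1] is [n] minus the half of [n]. *)
move=> Hf; apply: (@computable_ext (fun a => iteri (f a) (fun n u => n - u) 0)).
  by move=> a; elim: (f a) => [|n /= ->] //; lia.
apply: computable_iteri => //; last exact: computable_const.
apply: computable_sub; apply/computable_cfst || apply/computable_csnd;
  exact/computable_csnd/computable_id.
Qed.

Lemma computable_leq f g :
  computable f -> computable g -> computable (fun a => (f a <= g a : nat)).
Proof.
move=> Hf Hg; apply: (@computable_ext (fun a => 1 - (f a - g a))).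
  by move=> a; lia.
exact/computable_sub/computable_sub/Hg/Hf/computable_const.
Qed.

Lemma computable_negb (p : nat -> bool) :
  computable (fun a => p a : nat) -> computable (fun a => ~~ p a : nat).
Proof.
move=> Hp; apply: (@computable_ext (fun a => 1 - p a)); first by move=> a; case: (p a).
exact/computable_sub/Hp/computable_const.
Qed.

Lemma computable_andb (p q : nat -> bool) :
  computable (fun a => p a : nat) -> computable (fun a => q a : nat) ->
  computable (fun a => p a && q a : nat).
Proof.
move=> Hp Hq; apply: (@computable_ext (fun a => p a * q a)).
  by move=> a; case: (p a); case: (q a).
exact: computable_mul.
Qed.

Lemma computable_orb (p q : nat -> bool) :
  computable (fun a => p a : nat) -> computable (fun a => q a : nat) ->
  computable (fun a => p a || q a : nat).
Proof.
move=> Hp Hq; apply: (@computable_ext (fun a => ~~ (~~ p a && ~~ q a))).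
  by move=> a; case: (p a); case: (q a).
exact/computable_negb/computable_andb/computable_negb/Hq/computable_negb.
Qed.

Lemma computable_eqn f g :
  computable f -> computable g -> computable (fun a => (f a == g a : nat)).
Proof.
move=> Hf Hg; apply: (@computable_ext (fun a => (f a <= g a) && (g a <= f a))).
  by move=> a; rewrite eqn_leq.
by apply: computable_andb; apply: computable_leq.
Qed.

Lemma computable_odd f : computable f -> computable (fun a => (odd (f a) : nat)).
Proof.
move=> Hf; apply: (@computable_ext (fun a => f a - 2 * (f a)./2)).
  by move=> a; lia.
apply: computable_sub => //; apply: computable_mul; first exact: computable_const.
exact: computable_half.
Qed.

(** * Bits of numbers, bounded quantifiers and tests on finite sets *)

Definition bit (u i : nat) : bool := odd (u %/ 2 ^ i).

Lemma computable_bit f g :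
  computable f -> computable g -> computable (fun a => (bit (f a) (g a) : nat)).
Proof.
move=> Hf Hg.
apply: (@computable_ext (fun a => odd (iteri (g a) (fun _ u => u./2) (f a)))).
  move=> a; rewrite /bit; congr (nat_of_bool (odd _)).
  by elim: (g a) => [|i /= ->]; rewrite ?divn1 // expnS mulnC divnMA divn2.
apply: computable_odd; apply: computable_iteri => //.
exact/computable_half/computable_csnd/computable_csnd/computable_id.
Qed.

Fixpoint allb (p : nat -> bool) (b : nat) : bool :=
  if b is b'.+1 then p b' && allb p b' else true.

Lemma allbP (p : nat -> bool) b : reflect (forall i, i < b -> p i) (allb p b).
Proof.
apply: (iffP idP) => [|H].
  elim: b => //= b IH /andP[pb /IH H] i; rewrite ltnS leq_eqVlt => /orP[/eqP->|] //.
  exact: H.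
by elim: b H => //= b IH H; rewrite H //= IH // => i ib; apply: H; lia.
Qed.

Lemma computable_allb (p : nat -> nat -> bool) b :
  computable (fun a => p (cfst a) (csnd a) : nat) -> computable b ->
  computable (fun a => allb (p a) (b a) : nat).
Proof.
move=> Hp Hb.
apply: (@computable_ext (fun a => iteri (b a) (fun n u => p a n * u) 1)).
  by move=> a; elim: (b a) => [|n /= ->] //; case: (p a n); case: (allb _ _).
apply: (@computable_iteri b (fun a n u => p a n * u)) => //; last exact: computable_const.
apply: computable_mul; last exact/computable_csnd/computable_csnd/computable_id.
have /(computable_comp Hp) : computable (fun a => cpair (cfst a) (cfst (csnd a))).
  apply: computable_cpair; first exact/computable_cfst/computable_id.
  exact/computable_cfst/computable_csnd/computable_id.
by apply: computable_ext => a; rewrite !cpairE.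
Qed.

Definition exb (p : nat -> bool) (b : nat) : bool := ~~ allb (fun i => ~~ p i) b.

Lemma exbP (p : nat -> bool) b : reflect (exists2 i, i < b & p i) (exb p b).
Proof.
apply: (iffP idP) => [|[i ib pi]]; last first.
  by apply/negP => /allbP /(_ i ib); rewrite pi.
move=> H; apply: contrapT => H'; move/negP: H; apply; apply/allbP => i ib.
by apply/negP => pi; apply: H'; exists i.
Qed.

Lemma computable_exb (p : nat -> nat -> bool) b :
  computable (fun a => p (cfst a) (csnd a) : nat) -> computable b ->
  computable (fun a => exb (p a) (b a) : nat).
Proof.
move=> Hp Hb; apply: computable_negb; apply: computable_allb => //.
exact: computable_negb.
Qed.

Lemma computable_app3 (r : nat -> nat -> nat -> bool) f g h :
  computable (fun p => r (cfst p) (cfst (csnd p)) (csnd (csnd p)) : nat) ->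
  computable f -> computable g -> computable h ->
  computable (fun a => r (f a) (g a) (h a) : nat).
Proof.
move=> Hr Hf Hg Hh.
have /(computable_comp Hr) : computable (fun a => cpair (f a) (cpair (g a) (h a))).
  by do !apply: computable_cpair.
by apply: computable_ext => a; rewrite !cpairE.
Qed.

(** Bounding [i] by [v] loses nothing: the elements of a finite set are smaller than its index, by
    [bit_lt]. *)
Definition subb (v U : nat) : bool := allb (fun i => ~~ bit v i || bit U i) v.

Lemma computable_subb f g :
  computable f -> computable g -> computable (fun a => subb (f a) (g a) : nat).
Proof.
move=> Hf Hg; apply: computable_allb => //.
apply: computable_orb; [apply: computable_negb|];
  apply: computable_bit; try exact: (computable_csnd computable_id);
  by apply: computable_comp => //; exact: (computable_cfst computable_id).
Qed.

Ltac comp_step :=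
  match goal with
  | |- computable (fun a => a) => exact: computable_id
  | |- computable (fun=> ?k) => exact: computable_const
  | |- computable (fun a => nat_of_bool (_ && _)) => apply: computable_andb
  | |- computable (fun a => nat_of_bool (_ || _)) => apply: computable_orb
  | |- computable (fun a => nat_of_bool (~~ _)) => apply: computable_negb
  | |- computable (fun a => nat_of_bool (_ <= _)) => apply: computable_leq
  | |- computable (fun a => nat_of_bool (_ == _)) => apply: computable_eqn
  | |- computable (fun a => nat_of_bool (odd _)) => apply: computable_odd
  | |- computable (fun a => nat_of_bool (bit _ _)) => apply: computable_bit
  | |- computable (fun a => nat_of_bool (allb _ _)) => apply: computable_allb
  | |- computable (fun a => nat_of_bool (exb _ _)) => apply: computable_exb
  | |- computable (fun a => cfst _) => apply: computable_cfst
  | |- computable (fun a => csnd _) => apply: computable_csnd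
  | |- computable (fun a => cpair _ _) => apply: computable_cpair
  | |- computable (fun a => _.+1) => apply: computable_succ
  | |- computable (fun a => _.-1) => apply: computable_pred
  | |- computable (fun a => addn _ _) => apply: computable_add
  | |- computable (fun a => subn _ _) => apply: computable_sub
  | |- computable (fun a => muln _ _) => apply: computable_mul
  | |- computable (fun a => nat_of_bool (subb _ _)) => apply: computable_subb
  | H : computable (fun p => nat_of_bool (?r (cfst p) (cfst (csnd p)) (csnd (csnd p))))
      |- computable (fun a => nat_of_bool (?r _ _ _)) =>
      apply: (@computable_app3 r _ _ _ H)
  | H : computable ?f |- computable (fun a => ?f _) => apply: (computable_comp H)
  | |- computable ?g =>
      lazymatch g with fun _ => _ => fail | _ => change (computable (fun a => g a)) end
  end.
Ltac comp := repeat (cbv beta; comp_step).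

(** * Finite sets of naturals and finite collection principles *)

Lemma bit_lt u i : bit u i -> i < u.
Proof.
rewrite /bit; case: (posnP (u %/ 2 ^ i)) => [->//|]; rewrite divn_gt0 ?expn_gt0 //.
by move=> le _; apply: leq_trans le; apply: ltn_expl.
Qed.

Lemma bit0 i : bit 0 i = false.
Proof. by rewrite /bit div0n. Qed.

Lemma bit_halfE u i : bit u i.+1 = bit u./2 i.
Proof. by rewrite /bit expnS divnMA divn2. Qed.

(** Finite comprehension for an arbitrary, possibly undecidable [P]: bit 0 is chosen classically,
    and induction on the shifted predicate supplies the other bits. *)
Lemma bit_exists (P : nat -> Prop) N :
  exists u, forall i, bit u i <-> (i < N /\ P i).
Proof.
elim: N P => [|N IH] P; first by exists 0 => i; rewrite bit0; split=> // -[].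
have [u Hu] := IH (fun i => P i.+1).
exists (`[< P 0 >] + u.*2) => -[|i].
  rewrite /bit divn1 oddD odd_double addbF oddb.
  by split=> [/asboolP//|[_ ?]]; apply/asboolP.
rewrite bit_halfE halfD odd_double andbF add0n doubleK.
have -> : (`[< P 0 >] : nat)./2 = 0 by case: asbool.
by rewrite add0n Hu.
Qed.

(** Leaves finitely many indices for the subsets of a bounded set; with [M = 0], the empty set has
    index 0 only. *)
Lemma bit_bound u M : (forall i, bit u i -> i < M) -> u < 2 ^ M.
Proof.
elim: M u => [|M IH] u H.
  rewrite expn0 ltnS leqn0; apply/eqP.
  have [n] := ubnP u; elim: n u H => // n IHn u H lt_un.
  case: u => [//|u] in H lt_un *.
  have E : u.+1./2 = 0.
    by apply: IHn; [move=> i; rewrite -bit_halfE => /H|lia].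
  by have := H 0; rewrite /bit divn1; lia.
have : u./2 < 2 ^ M by apply: IH => i; rewrite -bit_halfE => /H.
by rewrite expnS; lia.
Qed.

Lemma canonicalP u i : canonical u i <-> bit u i.
Proof. by []. Qed.

Lemma subbP v U : subb v U <-> canonical v `<=` canonical U.
Proof.
split=> [/allbP H i vi|H]; first by have := H i (bit_lt vi); rewrite (vi : bit v i).
by apply/allbP => i _; apply/orP; case: (boolP (bit v i)) => [/H|]; [right|left].
Qed.

Lemma bounded_collection n (Q : nat -> nat -> Prop) :
  (forall i, i < n -> exists b, forall y, Q i y -> y < b) ->
  exists b, forall i, i < n -> forall y, Q i y -> y < b.
Proof.
elim: n => [|n IH] H; first by exists 0.
have [b Hb] : exists b, forall i, i < n -> forall y, Q i y -> y < b.
  by apply: IH => i lt_in; apply: H; lia.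
have [b' Hb'] := H n (ltnSn n).
exists (maxn b b') => i; rewrite ltnS leq_eqVlt => /orP[/eqP->|lt_in] y Qy.
  by have := Hb' y Qy; lia.
by have := Hb i lt_in y Qy; lia.
Qed.

Lemma monotone_collection n (Q : nat -> nat -> Prop) :
  (forall i m m', m <= m' -> Q i m -> Q i m') ->
  (forall i, i < n -> exists m, Q i m) -> exists m, forall i, i < n -> Q i m.
Proof.
move=> mono; elim: n => [|n IH] H; first by exists 0.
have [m Hm] : exists m, forall i, i < n -> Q i m.
  by apply: IH => i lt_in; apply: H; lia.
have [m' Hm'] := H n (ltnSn n).
exists (maxn m m') => i; rewrite ltnS leq_eqVlt => /orP[/eqP->|lt_in].
  by apply: mono Hm'; lia.
by apply: mono (Hm i lt_in); lia.
Qed.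

(* [sigma B P]: [P] is enumeration reducible to [B], see [sigma_ered]; this form
   has a decidable matrix and is easier to compose. *)
Definition sigma (B : set nat) (P : nat -> Prop) : Prop :=
  exists2 r : nat -> nat -> nat -> bool,
    computable (fun p => r (cfst p) (cfst (csnd p)) (csnd (csnd p)) : nat) &
    forall a, P a <-> exists N U, canonical U `<=` B /\ r a N U.

(** * Closure of enumeration reducibility under logical operations *)

Section SigmaClosure.

Variable B : set nat.

Lemma sigma_ext P Q : (forall a, P a <-> Q a) -> sigma B P -> sigma B Q.
Proof. by move=> PQ [r Hr HP]; exists r => // a; rewrite -PQ. Qed.

Lemma sigma_dec (p : nat -> bool) : computable (fun a => p a : nat) -> sigma B p.
Proof.
move=> Hp; exists (fun a _ _ => p a); first by [comp; refine (computable_comp Hp _); comp].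
move=> a; split=> [pa|[_ [_ [_ //]]]].
by exists 0, 0; split=> // i /canonicalP; rewrite bit0.
Qed.

Lemma sigma_oracle f : computable f -> sigma B (fun a => B (f a)).
Proof.
move=> Hf; exists (fun a _ U => bit U (f a)); first by comp.
move=> a; split=> [Ba|[_ [U [sUB /sUB //]]]].
have [u Hu] := bit_exists (fun i => i = f a) (f a).+1.
by exists 0, u; split=> [i /canonicalP /Hu [_ ->]//|]; apply/Hu; split.
Qed.

Lemma sigma_comp P f : sigma B P -> computable f -> sigma B (fun a => P (f a)).
Proof.
move=> [r Hr HP] Hf; exists (fun a N U => r (f a) N U) => [|a]; last exact: HP.
by comp.
Qed.

Lemma sigma_and P Q : sigma B P -> sigma B Q -> sigma B (fun a => P a /\ Q a).
Proof.
move=> [r Hr HP] [t Ht HQ].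
(* [N] packs both witnesses with their own finite subsets of the oracle. As [r] and [t] need not be
   monotone in the finite set, [U] only has to contain these subsets. *)
exists (fun a N U =>
  (subb (cfst (cfst N)) U && r a (csnd (cfst N)) (cfst (cfst N))) &&
  (subb (cfst (csnd N)) U && t a (csnd (csnd N)) (cfst (csnd N)))).
  by comp.
move=> a; split.
  case=> /HP[N [U [sU rN]]] /HQ[N' [U' [sU' tN']]].
  have [V HV] := bit_exists B (U + U').
  exists (cpair (cpair U N) (cpair U' N')), V; split; first by move=> i /HV [].
  rewrite !cpairE rN tN' !andbT; apply/andP; split; apply/subbP => i iU; apply/HV;
    (split; last by [apply: sU|apply: sU']); have /bit_lt : bit _ i := iU; lia.
case=> N [U [sU /andP[/andP[/subbP sV rN] /andP[/subbP sV' tN]]]].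
split; [apply/HP; exists (csnd (cfst N)), (cfst (cfst N))
  |apply/HQ; exists (csnd (csnd N)), (cfst (csnd N))]; split=> //;
  exact: subset_trans sU.
Qed.

Lemma sigma_or P Q : sigma B P -> sigma B Q -> sigma B (fun a => P a \/ Q a).
Proof.
move=> [r Hr HP] [t Ht HQ].
exists (fun a N U => r a N U || t a N U).
  by comp.
move=> a; split.
  by move=> [/HP|/HQ] [N [U [sU H]]]; exists N, U; rewrite H ?orbT.
by move=> [N [U [sU /orP[H|H]]]]; [left; apply/HP|right; apply/HQ]; exists N, U.
Qed.

Lemma sigma_ex (P : nat -> nat -> Prop) :
  sigma B (fun p => P (cfst p) (csnd p)) -> sigma B (fun a => exists w, P a w).
Proof.
move=> [r Hr HP]; exists (fun a N U => r (cpair a (cfst N)) (csnd N) U).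
  by comp.
move=> a; split=> [[w Pw]|[N [U [sU H]]]].
  have [|N [U [sU H]]] := (HP (cpair a w)).1; first by rewrite !cpairE.
  by exists (cpair w N), U; rewrite !cpairE.
by exists (cfst N); have := (HP (cpair a (cfst N))).2; rewrite !cpairE; apply; exists (csnd N), U.
Qed.

(* Collection: a single bound [N] on the witnesses for all [z < b a], and then
   a single finite subset of [B] containing all the finite sets coded below [N]. *)
Lemma sigma_ball (P : nat -> nat -> Prop) b :
  sigma B (fun p => P (cfst p) (csnd p)) -> computable b ->
  sigma B (fun a => forall z, z < b a -> P a z).
Proof.
move=> [r Hr HP] Hb.
exists (fun a N U => allb (fun z => exb (fun m => exb (fun V =>
  subb V U && r (cpair a z) m V) N) N) (b a)).
  by comp.
move=> a; split.
  move=> H.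
  have [N HN] : exists N, forall z, z < b a ->
      exists m V, [/\ m < N, V < N, canonical V `<=` B & r (cpair a z) m V].
    apply: monotone_collection => [z m m' le [x [V [? ? ? ?]]]|z /H Pz].
      by exists x, V; split=> //; lia.
    have [|m [V [sV rV]]] := (HP (cpair a z)).1; first by rewrite !cpairE.
    by exists (m + V).+1, m, V; split=> //; lia.
  have [U HU] := bit_exists B N.
  exists N, U; split; first by move=> i /HU [].
  apply/allbP => z /HN [m [V [lm lV sV rV]]].
  apply/exbP; exists m => //; apply/exbP; exists V => //.
  rewrite rV andbT; apply/subbP => i iV; apply/HU; split; last exact: sV.
  by have /bit_lt : bit V i := iV; lia.
move=> [N [U [sU /allbP H]]] z /H /exbP [m _ /exbP [V _ /andP[/subbP sV rV]]].
have := (HP (cpair a z)).2; rewrite !cpairE; apply; exists m, V.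
by split=> //; apply: subset_trans sU.
Qed.

End SigmaClosure.

Lemma sigma_imp B (p : nat -> bool) Q :
  computable (fun a => p a : nat) -> sigma B Q -> sigma B (fun a => p a -> Q a).
Proof.
move=> Hp HQ; apply: (@sigma_ext _ (fun a => ~~ p a \/ Q a)) => [a|].
  by case: (p a); intuition.
by apply: sigma_or HQ; apply: sigma_dec; comp.
Qed.

Ltac sigma_step :=
  match goal with
  | |- sigma _ (fun a => _ /\ _) => apply: sigma_and
  | |- sigma _ (fun a => _ \/ _) => apply: sigma_or
  | |- sigma _ (fun a => exists _, _) => apply: sigma_ex
  | |- sigma _ (fun a => forall z, is_true (z < _) -> _) =>
      apply: sigma_ball; [|by comp]
  | |- sigma _ (fun a => is_true _ -> _) => apply: sigma_imp; [by comp|]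
  | |- sigma _ (fun a => is_true _) => apply: sigma_dec; by comp
  | |- sigma ?B (fun a => ?B _) => apply: sigma_oracle; by comp
  end.
Ltac sigma_tac := repeat (cbv beta; sigma_step).

Lemma sigma_comp2 B (P : nat -> nat -> Prop) f g :
  sigma B (fun p => P (cfst p) (csnd p)) -> computable f -> computable g ->
  sigma B (fun a => P (f a) (g a)).
Proof.
move=> HP Hf Hg; have /(sigma_comp HP) : computable (fun a => cpair (f a) (g a)).
  by comp.
by apply: sigma_ext => a; rewrite !cpairE.
Qed.

(** * Enumerability of program evaluation, and [sigma] as enumeration reducibility *)

Lemma eval_zeroE x y : eval Zero x y <-> y == 0.
Proof. by split=> [H|/eqP->]; [inversion H|constructor]. Qed.

Lemma eval_succE x y : eval Succ x y <-> y == x.+1.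
Proof. by split=> [H|/eqP->]; [inversion H|constructor]. Qed.

Lemma eval_leftE x y : eval Left x y <-> y == cfst x.
Proof.
split=> [H|/eqP->]; first by inversion H; rewrite cpairE.
by rewrite -{1}[x]cpair_eta; constructor.
Qed.

Lemma eval_rightE x y : eval Right x y <-> y == csnd x.
Proof.
split=> [H|/eqP->]; first by inversion H; rewrite cpairE.
by rewrite -{1}[x]cpair_eta; constructor.
Qed.

Lemma eval_pairE f g x y :
  eval (Pair f g) x y <-> eval f x (cfst y) /\ eval g x (csnd y).
Proof.
split=> [H|[Hf Hg]]; first by inversion H; rewrite !cpairE.
by rewrite -[y]cpair_eta; constructor.
Qed.

Lemma eval_compE f g x y : eval (Comp f g) x y <-> exists u, eval g x u /\ eval f u y.
Proof.
split=> [H|[u [Hg Hf]]]; last exact: eval_comp Hg Hf.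
by inversion H as [| | | | |? ? ? u| | |]; exists u.
Qed.

Lemma eval_muE f a n :
  eval (Mu f) a n <->
  (forall i, i < n -> exists v, eval f (cpair a i) v.+1) /\ eval f (cpair a n) 0.
Proof.
split=> [H|[H H0]].
  by inversion H as [| | | | | | | |? ? ? v Hv]; split=> // i /Hv; exists (v i).
have /choice[v Hv] i : exists v, i < n -> eval f (cpair a i) v.+1.
  by case: (boolP (i < n)) => [/H[v Hv]|_]; [exists v|exists 0].
exact: (eval_mu (v := v)).
Qed.

(* A computation by primitive recursion is witnessed by a finite set of pairs
   (argument, value), each of which is justified by the others. *)
Lemma eval_precE f g x y :
  eval (Prec f g) x y <->
  exists D, bit D (cpair (csnd x) y) /\ forall q, q < D -> bit D q ->
    (cfst q == 0 /\ eval f (cfst x) (csnd q)) \/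
    exists u, (0 < cfst q /\ bit D (cpair (cfst q).-1 u)) /\
      eval g (cpair (cfst x) (cpair (cfst q).-1 u)) (csnd q).
Proof.
split=> [|[D [Dxy HD]]].
  rewrite -{1}[x]cpair_eta; move: (cfst x) (csnd x) => a n.
  elim: n y => [|n IH] y H; move Ep : (cpair a _) H => p H;
    inversion H as [| | | | | |? ? a' v Hf|? ? a' n' u v Hp Hg|]; subst => //;
    match goal with E : cpair _ _ = cpair _ _ |- _ => have [Ea En] := cpair_inj E end;
    subst => //.
    have [D HD] := bit_exists (fun q => q = cpair 0 y) (cpair 0 y).+1.
    exists D; split; first by apply/HD; split.
    by move=> q _ /HD [_ ->]; left; rewrite !cpairE.
  have {En} En : n' = n by lia.
  subst.
  have {IH} [D [Dn HD]] := IH _ Hp.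
  have [E HE] := bit_exists (fun q => bit D q \/ q = cpair n.+1 y)
    (D + cpair n.+1 y).+1.
  have DE q : bit D q -> bit E q.
    by move=> Dq; apply/HE; split; [have := bit_lt Dq; lia|left].
  exists E; split; first by apply/HE; split; [lia|right].
  move=> q _ /HE [_ [Dq|->]].
    have [[? ?]|[w [[? /DE ?] ?]]] := HD q (bit_lt Dq) Dq; first by left.
    by right; exists w.
  by right; exists u; rewrite !cpairE; do 2!split=> //; apply: DE.
rewrite -[x]cpair_eta; move: (csnd x) Dxy => n.
elim: n y => [|n IH] y Dy; have := HD _ (bit_lt Dy) Dy; rewrite !cpairE.
  by case=> [[_ H]|[u [[]]]] //; apply: eval_prec0.
by case=> [[]//|[u [[_ Du] H]]]; apply: eval_precS H; apply: IH.
Qed.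

(** Induction on the program: the characterisations above express each evaluation rule by
    connectives and quantifiers under which [sigma] is closed. *)
Lemma sigma_eval B c : sigma B (fun p => eval c (cfst p) (csnd p)).
Proof.
elim: c => [||||f IHf g IHg|f IHf g IHg|f IHf g IHg|f IHf].
- by apply: sigma_ext => [a|]; [symmetry; apply: eval_zeroE|sigma_tac].
- by apply: sigma_ext => [a|]; [symmetry; apply: eval_succE|sigma_tac].
- by apply: sigma_ext => [a|]; [symmetry; apply: eval_leftE|sigma_tac].
- by apply: sigma_ext => [a|]; [symmetry; apply: eval_rightE|sigma_tac].
- apply: sigma_ext => [a|]; first by symmetry; apply: eval_pairE.
  by sigma_tac; [apply: (sigma_comp2 IHf)|apply: (sigma_comp2 IHg)]; comp.
- apply: sigma_ext => [a|]; first by symmetry; apply: eval_compE.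
  by sigma_tac; [apply: (sigma_comp2 IHg)|apply: (sigma_comp2 IHf)]; comp.
- apply: sigma_ext => [a|]; first by symmetry; apply: eval_precE.
  by sigma_tac; [apply: (sigma_comp2 IHf)|apply: (sigma_comp2 IHg)]; comp.
- apply: sigma_ext => [a|]; first by symmetry; apply: eval_muE.
  by sigma_tac; apply: (sigma_comp2 IHf); comp.
Qed.

Lemma ce_sigma B G : ce G -> sigma B G.
Proof.
move=> [c ->]; apply: (@sigma_ext _ (fun a => exists y, eval c a y)) => //.
by sigma_tac; apply: sigma_eval.
Qed.

Lemma ce_ex (p : nat -> nat -> bool) :
  computable (fun a => p (cfst a) (csnd a) : nat) -> ce [set a | exists w, p a w].
Proof.
(* [Mu] searches for a zero, hence the negated test; a failing test has value 1, the successor of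
   0. *)
move=> /computable_negb [c Hc]; exists (Mu c); apply/seteqP; split=> a.
  move=> ex; exists (ex_minn ex); case: ex_minnP => m pm min.
  apply: (@eval_mu _ _ _ (fun=> 0)) => [i lt_im|].
    have := Hc (cpair a i); rewrite !cpairE; case: (boolP (p a i)) => // /min; lia.
  by have := Hc (cpair a m); rewrite !cpairE pm.
move=> [m /eval_muE [_ H]]; exists m.
have := eval_fun H (Hc _); rewrite !cpairE.
by case: (p a m).
Qed.

Lemma sigma0_ce P : sigma set0 P -> ce P.
Proof.
move=> [r Hr HP].
have -> : P = [set a | exists w, (fun a w => r a w 0) a w].
  apply/seteqP; split=> a.
    move=> /HP [N [U [sU rN]]]; exists N.
    (* Only the index 0 codes a subset of the empty oracle. *)
    have : U < 2 ^ 0 by apply: bit_bound => i /sU.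
    by rewrite expn0 ltnS leqn0 => /eqP <-.
  by move=> [w rw]; apply/HP; exists w, 0; split=> // i /canonicalP; rewrite bit0.
by apply: ce_ex; comp.
Qed.

Lemma sigma_ered A B : sigma B A <-> ered A B.
Proof.
split.
  move=> [r Hr HA].
  exists [set a | exists w, (fun a w => r (cfst a) w (csnd a)) a w].
    by apply: ce_ex; comp.
  apply/seteqP; split=> a.
    by move=> /HA [N [U [sU rN]]]; exists U => //; exists N; rewrite !cpairE.
  by move=> [U sU [N]]; rewrite !cpairE => rN; apply/HA; exists N, U.
move=> [G Gce ->].
apply: (@sigma_ext _ (fun a => exists u,
  (forall i, i < u -> bit u i -> B i) /\ G (cpair a u))) => [a|].
  split=> [[u [H Gu]]|[u H Gu]]; exists u => //; last by split=> // i _ /H.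
  by move=> i ui; apply: H => //; apply: bit_lt.
by sigma_tac; apply: (sigma_comp (ce_sigma _ Gce)); comp.
Qed.

(** * Decidability in the oracle: a predicate and its complement both enumerable from it *)

Definition delta B P := sigma B P /\ sigma B (fun a => ~ P a).

Section DeltaClosure.

Variable B : set nat.

Lemma delta_dec (p : nat -> bool) : computable (fun a => p a : nat) -> delta B p.
Proof.
move=> Hp; split; first exact: sigma_dec.
apply: (@sigma_ext _ (fun a => ~~ p a)) => [a|]; first by split=> /negP.
by apply: sigma_dec; comp.
Qed.

Lemma delta_not P : delta B P -> delta B (fun a => ~ P a).
Proof. by case=> HP HnP; split=> //; apply: sigma_ext HP => a; rewrite notK. Qed.

Lemma delta_and P Q : delta B P -> delta B Q -> delta B (fun a => P a /\ Q a).
Proof.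
move=> [HP HnP] [HQ HnQ]; split; first exact: sigma_and.
by apply: sigma_ext (sigma_or HnP HnQ) => a; rewrite not_andE.
Qed.

Lemma delta_or P Q : delta B P -> delta B Q -> delta B (fun a => P a \/ Q a).
Proof.
move=> [HP HnP] [HQ HnQ]; split; first exact: sigma_or.
by apply: sigma_ext (sigma_and HnP HnQ) => a; rewrite not_orE.
Qed.

Lemma delta_imp P Q : delta B P -> delta B Q -> delta B (fun a => P a -> Q a).
Proof.
move=> [HP HnP] [HQ HnQ]; split.
  by apply: sigma_ext (sigma_or HnP HQ) => a; rewrite implyE.
by apply: sigma_ext (sigma_and HP HnQ) => a; rewrite not_implyE.
Qed.

Lemma delta_ball (P : nat -> nat -> Prop) b :
  delta B (fun p => P (cfst p) (csnd p)) -> computable b ->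
  delta B (fun a => forall z, z < b a -> P a z).
Proof.
move=> [HP HnP] Hb; split; first exact: sigma_ball.
apply: (@sigma_ext _ (fun a => exists z, z < b a /\ ~ P a z)) => [a|].
  split=> [[z [lt nP] /(_ z lt)]//|]; apply: contra_notP => H z lt.
  by apply: contrapT => nP; apply: H; exists z.
by sigma_tac.
Qed.

Lemma delta_bex (P : nat -> nat -> Prop) b :
  delta B (fun p => P (cfst p) (csnd p)) -> computable b ->
  delta B (fun a => exists z, z < b a /\ P a z).
Proof.
move=> [HP HnP] Hb; split; first by sigma_tac.
apply: (@sigma_ext _ (fun a => forall z, z < b a -> ~ P a z)) => [a|].
  by split=> [H [z [/H]]|H z lt Pz] //; apply: H; exists z.
exact: sigma_ball.
Qed.

Lemma delta_sigma P : delta B P -> sigma B P.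
Proof. by case. Qed.

End DeltaClosure.

(** * The structure of $0'_e$ and its non-enumerability *)

Lemma Kset0E e x : Kset set0 (cpair e x) <-> Gam e (cpair x 0).
Proof.
split=> [[e' [x' [/cpair_inj[<- <-]]]]|H].
  move=> [u su]; have : u < 2 ^ 0 by apply: bit_bound => i /su.
  by rewrite expn0 ltnS leqn0 => /eqP ->.
by exists e, x; split=> //; exists 0 => // i /canonicalP; rewrite bit0.
Qed.

Lemma zero_ejump_double q : zero_ejump (2 * q) <-> Kset set0 q.
Proof.
have E : odd (2 * q) = false by lia.
have E' : (2 * q)./2 = q by lia.
by rewrite /zero_ejump /ejump /ejoin /= E E'.
Qed.

Lemma zero_ejump_doubleS q : zero_ejump (2 * q + 1) <-> ~ Kset set0 q.
Proof.
have E : odd (2 * q + 1) by lia.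
have E' : (2 * q + 1)./2 = q by lia.
by rewrite /zero_ejump /ejump /ejoin /= E E'.
Qed.

(** The map exchanges [2 * q] and [2 * q + 1], hence the two halves of the join. So the complement
    of $0'_e$ reduces to $0'_e$. *)
Lemma not_zero_ejump n : ~ zero_ejump n <-> zero_ejump (n.+1 - 2 * odd n).
Proof.
have [o|e] := boolP (odd n).
  rewrite (_ : n = 2 * n./2 + 1); last by lia.
  rewrite (_ : _ - _ = 2 * n./2); last by lia.
  by rewrite zero_ejump_double zero_ejump_doubleS notK.
rewrite (_ : _ - _ = 2 * n./2 + 1); last by lia.
by rewrite {1}(_ : n = 2 * n./2) ?zero_ejump_double ?zero_ejump_doubleS; last by lia.
Qed.

Lemma zero_ejump_unbounded k : exists2 z, k <= z & zero_ejump z.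
Proof.
have [H|H] := pselect (Kset set0 k).
  by exists (2 * k); [lia|apply/zero_ejump_double].
by exists (2 * k + 1); [lia|apply/zero_ejump_doubleS].
Qed.

(* [4 * cpair e 2 + 5] is the number of the program [Comp c Left], where [c] is
   the program numbered [e]; it halts on [cpair x 0] iff [c] halts on [x]. *)
Lemma Gam_zero_ejump e q :
  Gam e q <-> zero_ejump (2 * cpair (4 * cpair e 2 + 5) q).
Proof.
rewrite zero_ejump_double Kset0E.
have [c <-] := code_num_surj e.
rewrite -[4 * _ + 5]/(code_num (Comp c Left)) !Gam_code_num; split.
  by move=> [y H]; exists y; apply/eval_compE; exists q; split=> //; constructor.
by move=> [y /eval_compE [u [/eval_leftE /eqP ->]]]; rewrite cpairE => H; exists y.
Qed.

Lemma delta_zero_ejump g :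
  computable g -> delta zero_ejump (fun a => zero_ejump (g a)).
Proof.
move=> Hg; split; first exact: sigma_oracle.
apply: (@sigma_ext _ (fun a => zero_ejump ((g a).+1 - 2 * odd (g a)))) => [a|].
  by symmetry; apply: not_zero_ejump.
by apply: sigma_oracle; comp.
Qed.

Lemma delta_Gam g h :
  computable g -> computable h -> delta zero_ejump (fun a => Gam (g a) (h a)).
Proof.
move=> Hg Hh.
have [HP HnP] : delta zero_ejump
    (fun a => zero_ejump (2 * cpair (4 * cpair (g a) 2 + 5) (h a))).
  by apply: delta_zero_ejump; comp.
split; first by apply: sigma_ext HP => a; symmetry; apply: Gam_zero_ejump.
by apply: sigma_ext HnP => a; rewrite Gam_zero_ejump.
Qed.

Lemma delta_canonical B g h :
  computable g -> computable h -> delta B (fun a => canonical (g a) (h a)).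
Proof.
by move=> Hg Hh; apply: (@delta_dec _ (fun a => bit (g a) (h a))); comp.
Qed.

Ltac delta_step :=
  match goal with
  | |- delta _ (fun a => ~ _) => apply: delta_not
  | |- delta _ (fun a => _ /\ _) => apply: delta_and
  | |- delta _ (fun a => _ \/ _) => apply: delta_or
  | |- delta _ (fun a => exists z, is_true (z < _) /\ _) =>
      apply: delta_bex; [|by comp]
  | |- delta _ (fun a => forall z, is_true (z < _) -> _) =>
      apply: delta_ball; [|by comp]
  | |- delta _ (fun a => canonical _ _) => apply: delta_canonical; by comp
  | |- delta _ (fun a => Gam _ _) => apply: delta_Gam; by comp
  | |- delta _ (fun a => zero_ejump _) => apply: delta_zero_ejump; by comp
  | |- delta _ (fun a => is_true _) => apply: delta_dec; by comp
  | |- delta _ (fun a => _ -> _) => apply: delta_imp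
  end.
Ltac delta_tac := repeat (cbv beta; delta_step).

Lemma zero_ejump_not_ce : ~ ce zero_ejump.
Proof.
move=> /(ce_sigma set0) HZ.
(* The diagonal is read through [cfst q] because [cpair e e] lies in [Kset set0] iff [cpair e 0]
   lies in [Gam e]: the index [e] meets itself at the input [cpair e 0]. *)
have : ce (fun q => zero_ejump (2 * cpair (cfst q) (cfst q) + 1)).
  by apply: sigma0_ce; apply: (sigma_comp HZ); comp.
move=> /ceP [e He].
have : Gam e (cpair e 0) <-> zero_ejump (2 * cpair e e + 1).
  by rewrite -He cpairE.
by rewrite zero_ejump_doubleS Kset0E; tauto.
Qed.

(** * The two rules and the diagonal set *)

Section Diagonalization.

Variable f : nat -> nat.
Hypothesis computable_f : computable f.

Let Z := zero_ejump.
Let A n := eop (Gam (f n)) Z.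

Hypothesis A_incomplete : forall n, ~ ered Z (A n).

(** Only the element and the axiom are bounded by [s]; $0'_e$ and [Gam] are consulted exactly, both
    being decidable in $0'_e$. *)
Definition stage n s q :=
  q < s /\ exists u, u < s /\
    ((forall i, i < u -> canonical u i -> zero_ejump i) /\ Gam (f n) (cpair q u)).

Lemma stage_mono n s s' q : s <= s' -> stage n s q -> stage n s' q.
Proof. by move=> le [lt [u [ltu H]]]; split; [lia|exists u; split=> //; lia]. Qed.

Lemma stage_eop n s q : stage n s q -> A n q.
Proof.
by move=> [_ [u [_ [H G]]]]; exists u => // i ui; apply: H => //; apply: bit_lt.
Qed.

Lemma eop_stage n q : A n q -> exists s, stage n s q.
Proof.
move=> [u su G]; exists (q + u).+1; split; first lia.
by exists u; split; [lia|split=> // i _ /su].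
Qed.

Lemma delta_stage n s q : computable n -> computable s -> computable q ->
  delta zero_ejump (fun a => stage (n a) (s a) (q a)).
Proof. by move=> Hn Hs Hq; rewrite /stage; delta_tac. Qed.

(* [forces e F w]: adding to the finite set coded by [F] some elements of columns
   beyond [e] puts into Gam_e(X) an element outside of Z; [w] codes the axiom used. *)
Definition forces e F w :=
  ~ zero_ejump (cfst w) /\ Gam e w /\
  forall q, q < csnd w -> canonical (csnd w) q -> canonical F q \/ e < cfst q.

Lemma delta_forces e F w : computable e -> computable F -> computable w ->
  delta zero_ejump (fun a => forces (e a) (F a) (w a)).
Proof. by move=> He HF Hw; rewrite /forces; delta_tac. Qed.

(** [S] occurs positively only, which makes the rule monotone. The first implication drives [s] up
    as [csnd p] grows. *)
Definition coding_rule (S : set nat) p :=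
  zero_ejump (csnd p) /\ exists s, forall z, z < csnd p ->
    (zero_ejump z -> stage (cfst p) s (cpair (cfst p) z)) /\
    (stage (cfst p) s (cpair (cfst p) z) ->
       zero_ejump z \/ S (cpair (cfst p) z)).

(** Since [e < cfst p], only finitely many [e] act on a given column; minimality of [w] leaves one
    finite set to add for each [e] and [F]. *)
Definition forcing_rule (S : set nat) p :=
  exists e F, (e < cfst p /\
    forall i, i < F -> canonical F i -> S i /\ cfst i <= e) /\
    exists w, forces e F w /\ (forall w', w' < w -> ~ forces e F w') /\
      canonical (csnd w) p.

Definition justified S p := coding_rule S p \/ forcing_rule S p.

Lemma justified_mono S T p : S `<=` T -> justified S p -> justified T p.
Proof.
move=> ST [[Zp [s Hs]]|[e [F [[lt HF] H]]]]; [left|right].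
  by split=> //; exists s => z /Hs [H1 H2]; split=> // /H2 [|/ST]; [left|right].
by exists e, F; split=> //; split=> // i lti /(HF i lti) [/ST].
Qed.

(** Finiteness of [D] turns membership into an existential statement over numbers, as enumerability
    from $0'_e$ requires. *)
Definition diag : set nat :=
  [set q | exists D, canonical D q /\
     forall p, p < D -> canonical D p -> justified (canonical D) p].

Lemma sigma_diag : sigma zero_ejump diag.
Proof.
apply: sigma_ex; apply: sigma_and.
  by apply: delta_sigma; delta_tac.
apply: sigma_ball; last by comp.
apply: (@sigma_imp _ (fun a => bit (csnd (cfst a)) (csnd a))); first by comp.
apply: sigma_or.
  apply: sigma_and; first by apply: delta_sigma; delta_tac.
  apply: sigma_ex; apply: delta_sigma.
  by delta_tac; apply: delta_stage; comp.
apply: sigma_ex; apply: sigma_ex; apply: sigma_and.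
  by apply: delta_sigma; delta_tac.
apply: sigma_ex; apply: delta_sigma.
by delta_tac; apply: delta_forces; comp.
Qed.

Lemma diag_justified p : diag p -> justified diag p.
Proof.
move=> [D [Dp HD]]; apply: justified_mono (HD p (bit_lt Dp) Dp) => q Dq.
by exists D.
Qed.

(** By monotonicity, a union of two self-justifying finite sets is self-justifying, so witnesses for
    the elements below [M] can be merged. *)
Lemma diag_bounded_witness M :
  exists2 D, (forall p, p < M -> diag p -> canonical D p) &
    forall p, p < D -> canonical D p -> justified (canonical D) p.
Proof.
elim: M => [|M [D HM HD]]; first by exists 0.
have [[E [EM HE]]|nM] := pselect (diag M); last first.
  exists D => // p; rewrite ltnS leq_eqVlt => /orP[/eqP-> /nM//|]; exact: HM.
have [U HU] := bit_exists (fun q => bit D q \/ bit E q) (D + E).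
have DU : canonical D `<=` canonical U.
  by move=> q Dq; apply/HU; split; [have := bit_lt Dq; lia|left].
have EU : canonical E `<=` canonical U.
  by move=> q Eq; apply/HU; split; [have := bit_lt Eq; lia|right].
exists U => [p|p _ /HU [_ [Dp|Ep]]].
- rewrite ltnS leq_eqVlt => /orP[/eqP-> _|/HM H /H /DU//]; exact: EU.
- exact: justified_mono DU (HD p (bit_lt Dp) Dp).
- exact: justified_mono EU (HE p (bit_lt Ep) Ep).
Qed.

(* Both rules look at a finite part of the set only. *)
Lemma justified_compact S p : justified S p ->
  exists M, forall T : set nat, (forall q, q < M -> S q -> T q) -> justified T p.
Proof.
move=> [[Zp [s Hs]]|[e [F [[lt HF] H]]]].
  exists (cpair (cfst p) (csnd p)); rewrite cpair_eta => T ST; left; split=> //.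
  exists s => z lt; have [H1 H2] := Hs z lt; split=> // /H2 [|Sz]; first by left.
  by right; apply: ST => //; rewrite -[X in _ < X]cpair_eta; apply: cpair_lt.
exists F => T ST; right; exists e, F; split=> //; split=> // i lti Fi.
by have [Si lei] := HF i lti Fi; split=> //; apply: ST.
Qed.

(** By compactness some self-justifying finite set already justifies [p]; adding [p] to it keeps it
    self-justifying. *)
Lemma justified_diag p : justified diag p -> diag p.
Proof.
move=> /justified_compact [M HM].
have [D HD JD] := diag_bounded_witness M.
have Jp := HM _ HD.
have [U HU] := bit_exists (fun q => bit D q \/ q = p) (D + p).+1.
have DU : canonical D `<=` canonical U.
  by move=> q Dq; apply/HU; split; [have := bit_lt Dq; lia|left].
exists U; split; first by apply/HU; split; [lia|right].
move=> q _ /HU [_ [Dq|->]]; apply: justified_mono DU _ => //.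
exact: JD (bit_lt Dq) Dq.
Qed.

(** * Finiteness of the columns of the diagonal set *)

Lemma forcing_bounded n M :
  (forall q, diag q -> cfst q < n -> q < M) ->
  exists m, forall p, cfst p = n -> forcing_rule diag p -> p < m.
Proof.
move=> HM.
pose Q e F p := exists w, forces e F w /\ (forall w', w' < w -> ~ forces e F w') /\
  canonical (csnd w) p.
(* There are finitely many [e < n] and finitely many [F] with elements below [M]; each pair
   contributes at most the finite set coded in its unique least [w]. *)
have [m Hm] : exists m, forall e, e < n -> forall p,
    (exists2 F, F < 2 ^ M & Q e F p) -> p < m.
  apply: bounded_collection => e _.
  have [m Hm] : exists m, forall F, F < 2 ^ M -> forall p, Q e F p -> p < m.
    apply: bounded_collection => F _.
    have [[w [Hw min]]|none] :=
      pselect (exists w, forces e F w /\ forall w', w' < w -> ~ forces e F w').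
      exists (csnd w) => p [w' [Hw' [min' wp]]]; suff -> : w = w' by apply: bit_lt.
      have [lt|lt|//] := ltngtP w w'; first by have := min' w lt.
      by have := min w' lt.
    by exists 0 => p [w [Hw [min _]]]; case: none; exists w.
  by exists m => p [F ltF]; apply: Hm.
exists m => p En [e [F [[lt HF] HQ]]]; apply: (Hm e); first by rewrite -En.
exists F => //.
apply: bit_bound => i Fi; have [Xi le] := HF i (bit_lt Fi) Fi.
by apply: HM => //; lia.
Qed.

(* If column [n] of [diag] were infinite, the coding rule would make the [n]-th
   column of [A n] equal to [Z] up to finitely many elements. *)
Lemma column_bounded n M :
  (forall q, diag q -> cfst q < n -> q < M) ->
  exists m, forall y, diag (cpair n y) -> y < m.
Proof.
move=> /forcing_bounded [m Hm].
apply: contrapT => unb; apply: (@A_incomplete n); apply/sigma_ered.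
(* Beyond [m] the forcing rule is silent in column [n], so unboundedness must come from the coding
   rule. *)
have large k : exists2 y, k <= y & coding_rule diag (cpair n y).
  apply: contrapT => none; apply: unb; exists (k + m) => y Xy.
  rewrite ltnNge; apply/negP => le.
  have [P|N] := diag_justified Xy; first by apply: none; exists y => //; lia.
  have := Hm _ (cfst_cpair n y) N; have := (cpair_ge n y).2; lia.
(* [d] records the part of [Z] below [m], where forcing may disturb the column. *)
have [d Hd] := bit_exists Z m.
apply: (@sigma_ext _ (fun z => (z < m /\ bit d z) \/ (m <= z /\ A n (cpair n z)))).
  move=> z; split=> [[[_ /Hd[]//]|[le Az]]|Zz]; last first.
    case: (ltnP z m) => [lt|le]; first by left; split=> //; apply/Hd.
    right; split=> //; have [y lty [_ [s]]] := large z.+1.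
    by rewrite !cpairE => /(_ z lty) [/(_ Zz) /stage_eop].
  (* Coding past some [z' >= s0] in [Z] uses a stage [s] containing [cpair n z'], so [s > s0] and
     [cpair n z] is in that stage too. Then [z] is in [Z], or [cpair n z] is in [diag]; as [z >= m],
     it came from coding, which again gives [z] in [Z]. *)
  have [s0 Hs0] := eop_stage Az.
  have [z' lez' Zz'] := zero_ejump_unbounded s0.
  have [y lty [_ [s]]] := large (z + z').+1; rewrite !cpairE => Hs.
  have [|/(_ Zz') [lts _] _] := Hs z' _; first lia.
  have [|_ H] := Hs z _; first lia.
  have [|//|Xz] := H; first by apply: stage_mono Hs0; have := (cpair_ge n z').2; lia.
  have [[]|N] := diag_justified Xz; first by rewrite cpairE.
  by have := Hm _ (cfst_cpair n z) N; have := (cpair_ge n z).2; lia.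
by sigma_tac; apply: sigma_oracle; comp.
Qed.

(** Induction on columns: a bound on the earlier ones limits forcing into the next, and
    [column_bounded] then applies to it. *)
Lemma columns_bounded n : exists M, forall q, diag q -> cfst q < n -> q < M.
Proof.
elim: n => [|n [M HM]]; first by exists 0.
have [m Hm] := column_bounded HM.
have [b Hb] : exists b, forall y, y < m -> forall q, q = cpair n y -> q < b.
  by apply: bounded_collection => y _; exists (cpair n y).+1 => q ->.
exists (maxn M b) => q Xq; rewrite ltnS leq_eqVlt => /orP[/eqP E|lt].
  have E' : q = cpair n (csnd q) by rewrite -E cpair_eta.
  have := Hb (csnd q) _ q E'; rewrite leq_max => ->; rewrite ?orbT //.
  by apply: Hm; rewrite -E'.
by rewrite leq_max HM.
Qed.

(** * The diagonal set differs from every listed set and is incomplete *)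

Lemma diag_neq n : A n <> diag.
Proof.
move=> E.
(* If [A n] were [diag], the coding rule would never stop: by strong induction the smaller elements
   of [Z] are already in the column, and whatever a stage of [A n] contains is in [diag]. This makes
   column [n] infinite. *)
have Zdiag y : Z y -> diag (cpair n y).
  have [k] := ubnP y; elim: k y => // k IH y lt_yk Zy.
  apply: justified_diag; left; rewrite /coding_rule !cpairE; split=> //.
  have [s Hs] : exists s, forall z, z < y ->
      A n (cpair n z) -> stage n s (cpair n z).
    apply: monotone_collection => [z s s' le H /H|z _]; first exact: stage_mono.
    have [/eop_stage[s Hs]|nA] := pselect (A n (cpair n z)); first by exists s.
    by exists 0.
  exists s => z lt; split=> [Zz|/stage_eop]; last by rewrite E; right.
  by apply: Hs => //; rewrite E; apply: IH => //; lia.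
have [M HM] := columns_bounded n.+1.
have [z le /Zdiag /HM] := zero_ejump_unbounded M.
by rewrite cpairE => /(_ (ltnSn n)); have := (cpair_ge n z).2; lia.
Qed.

Lemma diag_incomplete : ~ ered Z diag.
Proof.
move=> [G /ceP [e ->] E].
have [M HM] := columns_bounded e.+1.
(* [F] is the whole part of [diag] in columns up to [e], finite by [columns_bounded]. *)
have [F HF] := bit_exists (fun q => diag q /\ cfst q <= e) M.
have [ex|none] := pselect (exists w, `[< forces e F w >]).
  (* The forcing rule puts the least such axiom's finite set into [diag], so the operator outputs an
     element outside [Z]. *)
  case: (ex_minnP ex) => w /asboolP fw min.
  have [nZ [Gw sw]] := fw; apply: nZ; rewrite -/Z E.
  exists (csnd w); last by rewrite cpair_eta.
  move=> q wq; have [/HF[_ []]//|lt] := sw q (bit_lt wq) wq.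
  apply: justified_diag; right; exists e, F; split; first split=> //.
    by move=> i _ /HF [].
  exists w; split=> //; split=> // w' lt' fw'.
  by have := min w' (introT (asboolP _) fw'); lia.
(* With nothing to force, each axiom confined to [F] and the columns beyond [e] outputs an element
   of [Z]. These axioms include all those satisfied by [diag], so they enumerate exactly [Z] without
   an oracle. *)
apply: zero_ejump_not_ce; apply: sigma0_ce.
apply: (@sigma_ext _ (fun x => exists v, Gam e (cpair x v) /\
    forall q, q < v -> bit v q -> bit F q \/ e < cfst q)) => [x|].
  split=> [[v [Gv sv]]|].
    apply: contrapT => nZ; apply: none; exists (cpair x v); apply/asboolP.
    by rewrite /forces !cpairE; split.
  rewrite -/Z E => -[v sv Gv]; exists v; split=> // q _ /sv Xq.
  have [lt|le] := ltnP e (cfst q); [by right|left].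
  by apply/HF; split=> //; apply: HM.
sigma_tac; apply: (@sigma_comp _ (Gam e)); last by comp.
by apply: ce_sigma; apply/ceP; exists e.
Qed.

End Diagonalization.

Theorem theorem3p5 : ~ has_Ahmad_sequence zero_ejump.
Proof.
move=> [f [computable_f rangeE]].
have below n : eredlt (eop (Gam (f n)) zero_ejump) zero_ejump.
  suff : [set X | eredlt X zero_ejump] (eop (Gam (f n)) zero_ejump) by [].
  by rewrite -rangeE; exists n.
have incomplete n := (below n).2.
(* Lying strictly below $0'_e$, the diagonal set would have to occur in the listing. *)
have : [set X | eredlt X zero_ejump] (diag f).
  split; first by apply/sigma_ered; apply: sigma_diag.
  exact: diag_incomplete incomplete.
by rewrite -rangeE => -[n _]; apply: diag_neq.
Qed.
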